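(* Let $G$ be a group with presentation $\langle x,t\mid w\rangle$, where $w$ is a monic word in the free group on $x,t$. If all (complex) roots of $A_w(X)$ are real and positive, then $G$ is bi-orderable.
   Context: A group $G$ is bi-orderable if there is a total order $<$ on $G$ such that $u<v$ implies $ux<vx$ and $xu<xv$ for all $u,v,x\in G$. Write $a^b=b^{-1}ab$. Let $F$ be the free group on $x,t$ and $N$ the normal subgroup of $F$ generated by $x$; $N'$ is its derived subgroup. Let $w\in F$ be a non-identity element with exponent sum of $t$ equal to zero. Then $w\in N$ and $w$ is given by an expression $$w=(x^{m_1})^{t^{d_1}}\cdots (x^{m_r})^{t^{d_r}}$$ with $r\ge 1$ and integers $d_i,m_i$. For $j\in\mathbb{Z}$ let $\tau_j(w)=\{i\mid d_i=j\}$ (with respect to this expression) and $S_w=\{j\mid \sum_{i\in\tau_j(w)}m_i\ne 0\}$; $S_w=\emptyset$ if and only if $w\in N'$. If $w\in N\setminus N'$, let $e_w$ and $d_w$ be the smallest and largest elements of $S_w$, and let $A_w(X)=\sum_{i=1}^r m_iX^{d_i-e_w}$, a polynomial in $\mathbb{Z}[X]$ with non-zero constant coefficient. The word $w$ is tidy if $w\in N\setminus N'$ and $\tau_j(w)=\emptyset$ for all $j>d_w$ and all $j<e_w$. It is principal if it is tidy and $\tau_{d_w}(w)$ contains exactly one element. It is monic if it is principal and $m_k=1$, where $k$ is the unique element of $\tau_{d_w}(w)$. *)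

(* Defs.v *)
From HB Require Import structures.
From mathcomp Require Import all_boot all_order all_algebra.
From mathcomp Require Import all_classical all_reals.
From mathcomp Require Import complex.
Set Implicit Arguments.
Unset Strict Implicit.
Unset Printing Implicit Defensive.
Import Order.TTheory GRing.Theory Num.Theory.
Local Open Scope group_scope.

Definition bi_orderable (G : groupType) : Prop :=
  exists lt : rel G,
    [/\ irreflexive lt, transitive lt,
        forall u v, u != v -> lt u v || lt v u
      & forall u v x, lt u v -> lt (u * x) (v * x) /\ lt (x * u) (x * v)].

(* The free group on T, as the group of freely reduced words; the letter
   (a, true) stands for the generator a and (a, false) for its inverse. *)
Section FreeGroup.
Variable T : choiceType.
Implicit Types (l : T * bool) (s u v : seq (T * bool)).

Definition inv_letter l := (l.1, ~~ l.2).

Definition reduced s := sorted (fun k l => l != inv_letter k) s.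

Definition push l s :=
  if s is k :: s' then if k == inv_letter l then s' else l :: s else [:: l].

Definition reduce_cat u v := foldr push v u.

Definition inv_word s := rev (map inv_letter s).

Lemma inv_letterK : involutive inv_letter.
Proof. by case=> a b; rewrite /inv_letter /= negbK. Qed.

Lemma push_reduced l s : reduced s -> reduced (push l s).
Proof.
case: s => [|k s] //= sR; case: ifPn => [_|kl]; first exact: path_sorted sR.
by rewrite /= kl.
Qed.

Lemma push_inv l s : reduced s -> push l (push (inv_letter l) s) = s.
Proof.
case: s => [|k s] /=; first by rewrite eqxx.
rewrite inv_letterK; case: eqP => [->|kl] /=; last by rewrite eqxx.
by case: s => [|k' s] //= /andP[/negPf->].
Qed.

Lemma reduce_cat_reduced u v : reduced v -> reduced (reduce_cat u v).
Proof. by move=> vR; elim: u => //= l u; apply: push_reduced. Qed.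

Lemma reduce_cat_push l u v : reduced u -> reduced v ->
  reduce_cat (push l u) v = push l (reduce_cat u v).
Proof.
case: u => [|k u] //= uR vR; case: eqP => [->|//].
by rewrite push_inv //; apply: reduce_cat_reduced.
Qed.

Lemma reduce_catA u v s : reduced v -> reduced s ->
  reduce_cat (reduce_cat u v) s = reduce_cat u (reduce_cat v s).
Proof.
move=> vR sR; elim: u => //= l u IHu.
by rewrite reduce_cat_push ?IHu //; apply: reduce_cat_reduced.
Qed.

Lemma reduce_cats0 u : reduced u -> reduce_cat u [::] = u.
Proof.
elim: u => //= l u IHu uR; rewrite IHu; last exact: path_sorted uR.
by case: u uR {IHu} => [|k u] //= /andP[/negPf->].
Qed.

Lemma inv_word_reduced s : reduced s -> reduced (inv_word s).
Proof.
rewrite /reduced /inv_word rev_sorted sorted_map; apply: sub_sorted => k l /=.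
by rewrite inv_letterK; apply: contraNneq => ->; rewrite ?inv_letterK.
Qed.

Lemma reduce_cat_invl s v : reduced v ->
  reduce_cat (inv_word s) (reduce_cat s v) = v.
Proof.
elim: s v => [|l s IHs] v vR //=.
rewrite /inv_word /= rev_cons -cats1 /reduce_cat foldr_cat /=.
rewrite -{1}(inv_letterK l) inv_letterK.
have := push_inv (inv_letter l) (reduce_cat_reduced s vR).
by rewrite inv_letterK => ->; apply: IHs.
Qed.

Lemma inv_wordK : involutive inv_word.
Proof.
move=> s; rewrite /inv_word map_rev revK -map_comp -[RHS]map_id.
by apply: eq_map => l /=; apply: inv_letterK.
Qed.

Record free_group :=
  FreeGroup { free_word : seq (T * bool); _ : reduced free_word }.

HB.instance Definition _ := [isSub for free_word].
HB.instance Definition _ := [Choice of free_group by <:].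

Lemma free_wordP (w : free_group) : reduced (free_word w). Proof. by case: w. Qed.

Definition free_one : free_group := @FreeGroup [::] isT.
Definition free_mul (w z : free_group) : free_group :=
  FreeGroup (reduce_cat_reduced (free_word w) (free_wordP z)).
Definition free_inv (w : free_group) : free_group :=
  FreeGroup (inv_word_reduced (free_wordP w)).
Definition free_gen (a : T) : free_group := @FreeGroup [:: (a, true)] isT.

Lemma free_mulA : associative free_mul.
Proof. by move=> u v w; apply/val_inj; rewrite /= reduce_catA ?free_wordP. Qed.

Lemma free_mul1 : left_id free_one free_mul.
Proof. by move=> u; apply/val_inj. Qed.

Lemma free_mulr1 : right_id free_one free_mul.
Proof. by move=> u; apply/val_inj; rewrite /= reduce_cats0 ?free_wordP. Qed.

Lemma free_mulV : left_inverse free_one free_inv free_mul.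
Proof.
move=> u; apply/val_inj => /=.
by rewrite -{2}(reduce_cats0 (free_wordP u)) reduce_cat_invl.
Qed.

Lemma free_mulrV : right_inverse free_one free_inv free_mul.
Proof.
move=> u; rewrite -[X in free_mul X _](_ : free_inv (free_inv u) = u).
  exact: free_mulV.
by apply/val_inj; rewrite /= inv_wordK.
Qed.

HB.instance Definition _ := isGroup.Build free_group
  free_mulA free_mul1 free_mulr1 free_mulV free_mulrV.
End FreeGroup.

Section Subgroups.
Variable G : groupType.
Implicit Types H S : set G.

Definition subgroup H : Prop := H 1 /\ forall u v, H u -> H v -> H (u * v^-1).

Definition normal_subgroup H : Prop :=
  subgroup H /\ forall g u, H u -> H (u ^ g).

Definition normal_closure S : set G := smallest normal_subgroup S.

Definition derived_subgroup H : set G :=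
  smallest subgroup [set c | exists u v, [/\ H u, H v & c = [~ u, v]]].

Definition expgz (g : G) (n : int) : G :=
  match n with Posz k => g ^+ k | Negz k => g ^- k.+1 end.
End Subgroups.

Definition has_presentation (T : choiceType) (rels : set (free_group T))
    (G : groupType) : Prop :=
  exists f : {multiplicative free_group T -> G},
    (forall g, exists u, f u = g) /\
    (forall u, f u = 1 <-> normal_closure rels u).

(* The free group on x = gen_x and t = gen_t. *)
Notation F2 := (free_group bool).
Definition gen_x : F2 := free_gen false.
Definition gen_t : F2 := free_gen true.

Definition normal_x : set F2 := normal_closure [set gen_x]%classic.

Section Words.
Variables (r : nat) (m d : 'I_r -> int).

Definition word_of : F2 :=
  \prod_(i < r) (expgz gen_x (m i)) ^ (expgz gen_t (d i)).

Definition tau (j : int) : {set 'I_r} := [set i | d i == j].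

(* The set S_w, as an increasing sequence; a j with a nonzero sum is
   one of the d i. *)
Definition S_seq : seq int :=
  sort <=%R [seq j <- undup (codom d) | (\sum_(i in tau j) m i)%R != 0%R].

Definition e_min : int := head 0%R S_seq.
Definition d_max : int := last 0%R S_seq.

(* The polynomial A_w. The monomials with d i < e_min would have negative
   exponents; they are absent from tidy words, and cancel out for every w
   outside the derived subgroup of normal_x, so they are left out. *)
Definition A_poly : {poly int} :=
  (\sum_(i < r | e_min <= d i) m i *: 'X^(`|d i - e_min|%N))%R.

Definition expresses (w : F2) : Prop := (0 < r)%N /\ w = word_of.

Definition tidy_word (w : F2) : Prop :=
  [/\ expresses w, normal_x w, ~ derived_subgroup normal_x w
    & forall j : int, (d_max < j)%R || (j < e_min)%R -> tau j = finset.set0].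

Definition principal_word (w : F2) : Prop := tidy_word w /\ #|tau d_max| = 1%N.

Definition monic_word (w : F2) : Prop :=
  principal_word w /\ forall k, k \in tau d_max -> m k = 1%R.
End Words.

(* Main.v *)
(* Write w, up to conjugation by a power of t, as u x_K v where x_i = x^(t^i) and
   u, v are words in x_0, .., x_(K-1). Then G is an ascending HNN extension of
   the subgroup generated by x_0, .., x_(K-1): every element has the form
   t^a y t^-b with y in this subgroup, and conjugation by t maps x_i to x_(i+1) and
   x_(K-1) to the word u^-1 v^-1, hence acts on the abelianization by the
   companion matrix of A_w.

   Let the x_i act on words in K letters as 1 + y_i, with y_i in the span of the
   operators D_j removing the first letter j. Because D_j t = t phi_j determines t
   recursively, the action of t extends to words. In the Newton basis attached to
   the roots of A_w the operator t becomes triangular, with products of roots on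
   its diagonal, when words are ordered by length and then lexicographically.
   Truncating to the first n words gives homomorphisms of G to the groups of upper
   triangular matrices with positive diagonal. These groups are bi-orderable, and
   the homomorphisms are jointly injective: the factor 2 put on t makes the corner
   entry equal to 2^(a-b), and Magnus's argument shows that the x_i with i < K
   remain free. *)
Require Import Defs.
From HB Require Import structures.
From mathcomp Require Import all_boot all_order all_algebra.
From mathcomp Require Import all_classical all_reals.
From mathcomp Require Import complex.
From mathcomp Require Import zify ring.
Import Order.TTheory GRing.Theory Num.Theory.
Set Implicit Arguments.
Unset Strict Implicit.
Unset Printing Implicit Defensive.

(** * Lexicographic bi-orders *)

Section LexicographicOrder.
Local Open Scope group_scope.
Variables (G : groupType) (X : nat -> eqType) (ltX : forall p, rel (X p)).
Variable coord : forall p, G -> X p.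
Hypothesis ltX_irr : forall p, irreflexive (@ltX p).
Hypothesis ltX_trans : forall p, transitive (@ltX p).
Hypothesis ltX_total : forall p (a b : X p), a != b -> ltX a b || ltX b a.
Hypothesis coord_inj : forall u v, (forall p, coord p u = coord p v) -> u = v.
Hypothesis coord_mul : forall p u v g,
  (forall q, (q < p)%N -> coord q u = coord q v) ->
  ltX (coord p u) (coord p v) ->
  ltX (coord p (u * g)) (coord p (v * g)) /\ ltX (coord p (g * u)) (coord p (g * v)).

Let lexlt p u v := (forall q, (q < p)%N -> coord q u = coord q v) /\
  ltX (coord p u) (coord p v).

Let lexlt_total u v : u != v -> exists p, lexlt p u v \/ lexlt p v u.
Proof.
move=> uv; have /existsNP[p pP] : ~ forall p, coord p u = coord p v.
  by move=> E; move: uv; rewrite (coord_inj E) eqxx.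
have ex : exists p, coord p u != coord p v by exists p; apply/eqP.
have le : forall q, (q < ex_minn ex)%N -> coord q u = coord q v.
  move=> q; case: ex_minnP => n _ nmin; rewrite ltnNge; apply: contraNeq; exact: nmin.
exists (ex_minn ex); move: le; case: ex_minnP => n nuv _ le.
have [lt|lt] := orP (ltX_total nuv); [left|right]; split=> // q qn.
by rewrite le.
Qed.

Let lexlt_trans u v w p q : lexlt p u v -> lexlt q v w -> exists r, lexlt r u w.
Proof.
move=> [uv pl] [vw ql]; case: (ltngtP p q) => pq.
- exists p; split; last by rewrite -(vw _ pq).
  by move=> r rp; rewrite uv // vw // (ltn_trans rp).
- exists q; split; last by rewrite (uv _ pq).
  by move=> r rq; rewrite uv ?vw // (ltn_trans rq).
case: _ / pq ql vw => ql vw; exists p; split; last exact: ltX_trans pl ql.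
by move=> r rp; rewrite uv // vw.
Qed.

(* If [u * g] and [v * g] differed before index [p], then multiplying back by
   [g^-1] would show that [u] and [v] do so as well. *)
Let agree_mul p u v g : (forall q, (q < p)%N -> coord q u = coord q v) ->
  forall q, (q < p)%N -> coord q (u * g) = coord q (v * g) /\ coord q (g * u) = coord q (g * v).
Proof.
move=> uv q; elim/ltn_ind: q => q IHq qp.
have IH1 r : (r < q)%N -> coord r (u * g) = coord r (v * g).
  by move=> rq; have [] := IHq r rq (ltn_trans rq qp).
have IH2 r : (r < q)%N -> coord r (g * u) = coord r (g * v).
  by move=> rq; have [] := IHq r rq (ltn_trans rq qp).
have sym (x y : G) : (forall r, (r < q)%N -> coord r x = coord r y) ->
  forall r, (r < q)%N -> coord r y = coord r x by move=> h r /h.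
split; apply/eqP/negPn/negP => /ltX_total/orP[] l.
- by have [] := coord_mul g^-1 IH1 l; rewrite !mulgK uv // ltX_irr.
- by have [] := coord_mul g^-1 (sym _ _ IH1) l; rewrite !mulgK uv // ltX_irr.
- by have [] := coord_mul g^-1 IH2 l; rewrite !mulKg uv // ltX_irr.
- by have [] := coord_mul g^-1 (sym _ _ IH2) l; rewrite !mulKg uv // ltX_irr.
Qed.

Let lexlt_mul u v g p : lexlt p u v -> lexlt p (u * g) (v * g) /\ lexlt p (g * u) (g * v).
Proof.
move=> [uv pl]; have [l1 l2] := coord_mul g uv pl.
by split; split=> // q /(agree_mul g uv)[].
Qed.

(** Elements are compared at the first coordinate where they differ. By [agree_mul], multiplication
    preserves agreement below that index, so invariance reduces to [coord_mul]. *)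
Lemma lex_bi_orderable : bi_orderable G.
Proof.
exists (fun u v => `[< exists p, lexlt p u v >]); split.
- by move=> u; apply/asboolP => -[p [_]]; rewrite ltX_irr.
- move=> v u w /asboolP[p up] /asboolP[q vq]; apply/asboolP; exact: lexlt_trans up vq.
- move=> u v /lexlt_total[p [h|h]]; apply/orP; [left|right]; apply/asboolP; by exists p.
- move=> u v g /asboolP[p /(lexlt_mul g)[h1 h2]]; split; apply/asboolP; by exists p.
Qed.

End LexicographicOrder.

Section GroupMorphism.
Local Open Scope group_scope.
Variables (G H : groupType) (h : G -> H).
Hypothesis hM : {morph h : u v / u * v}.

Lemma morph_one : h 1 = 1.
Proof. by apply: (@mulgI _ (h 1)); rewrite -hM !mulg1. Qed.

Lemma morph_inv u : h u^-1 = (h u)^-1.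
Proof. by apply/esym/mulg1_eq; rewrite -hM mulgV morph_one. Qed.

Lemma morph_conj u v : h (u ^ v) = h u ^ h v.
Proof. by rewrite !conjgE !hM morph_inv. Qed.

Lemma morph_expgz u i : h (expgz u i) = expgz (h u) i.
Proof.
have hX k : h (u ^+ k) = h u ^+ k.
  by elim: k => [|k IHk]; rewrite ?morph_one // !expgS hM IHk.
by case: i => k /=; rewrite ?morph_inv hX.
Qed.

Lemma morph_prod I (r : seq I) (F : I -> G) :
  h (\prod_(i <- r) F i) = \prod_(i <- r) h (F i).
Proof. exact: (big_morph h hM morph_one). Qed.

End GroupMorphism.

Lemma residually_bi_orderable (G : groupType) (H : nat -> groupType)
    (h : forall n, G -> H n) :
  (forall n, {morph h n : u v / (u * v)%g}) -> (forall n, bi_orderable (H n)) ->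
  (forall g, (forall n, h n g = 1%g) -> g = 1%g) -> bi_orderable G.
Proof.
move=> hM Hord hker; pose lt n := projT1 (cid (Hord n)).
have ltP n := projT2 (cid (Hord n)).
apply: (@lex_bi_orderable G H lt h).
- by move=> n; have [] := ltP n.
- by move=> n; have [] := ltP n.
- by move=> n a b ab; have [_ _ + _] := ltP n; apply.
- move=> u v E; apply: divg1_eq; apply: hker => n.
  by rewrite hM (morph_inv (hM n)) E mulgV.
- by move=> n u v g _ l; rewrite !hM; have [_ _ _] := ltP n; apply.
Qed.

(** * Triangular matrices with positive diagonal *)

Section UpperTriangular.
Local Open Scope ring_scope.
Variables (R : realFieldType) (n : nat).
Implicit Types M N : 'M[R]_n.

Definition pos_upper M :=
  [forall a, (0 < M a a) && [forall b : 'I_n, (b < a)%N ==> (M a b == 0)]].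

Lemma pos_upperP M : reflect
  ((forall a, 0 < M a a) /\ forall a b : 'I_n, (b < a)%N -> M a b = 0) (pos_upper M).
Proof.
apply: (iffP forallP) => [h|[h1 h2] a]; last first.
  by rewrite h1; apply/forallP => b; apply/implyP => /h2->.
split=> [a|a b ba]; have /andP[Ma /forallP Mb] := h a => //.
by apply/eqP; move: (Mb b); rewrite ba.
Qed.

Lemma pos_upper_diag M N a : pos_upper M -> pos_upper N ->
  (M *m N) a a = M a a * N a a.
Proof.
move=> /pos_upperP[_ M0] /pos_upperP[_ N0].
rewrite mxE (bigD1 a) //= big1 ?addr0 // => c ca.
by case: (ltngtP c a) => [/M0->|/N0->|/val_inj E]; rewrite ?mul0r ?mulr0 ?E ?eqxx // in ca *.
Qed.

Lemma pos_upper1 : pos_upper 1%:M.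
Proof.
apply/pos_upperP; split=> [a|a b ba]; rewrite mxE ?eqxx // eq_sym.
by rewrite -val_eqE /= ltn_eqF.
Qed.

Lemma pos_upperM M N : pos_upper M -> pos_upper N -> pos_upper (M *m N).
Proof.
move=> Mu Nu; apply/pos_upperP; split=> [a|a b ba].
  rewrite pos_upper_diag //; move/pos_upperP: Mu => [M1 _]; move/pos_upperP: Nu => [N1 _].
  exact: mulr_gt0.
move/pos_upperP: Mu => [_ M0]; move/pos_upperP: Nu => [_ N0].
rewrite mxE big1 // => c _; case: (ltnP c a) => ca; first by rewrite M0 ?mul0r.
by rewrite N0 ?mulr0 // (leq_trans ba).
Qed.

Lemma pos_upper_unit M : pos_upper M -> M \in unitmx.
Proof.
move=> /pos_upperP[M1 M0]; rewrite unitmxE -det_tr det_trig.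
  by rewrite unitfE; apply/prodf_neq0 => i _; rewrite mxE gt_eqF.
by apply/is_trig_mxP => i j ij; rewrite mxE M0.
Qed.

Lemma pos_upperV M : pos_upper M -> pos_upper (invmx M).
Proof.
move=> Mu; have Munit := pos_upper_unit Mu; case/pos_upperP: (Mu) => M1 M0.
have V0 (a b : 'I_n) : (b < a)%N -> invmx M a b = 0.
  (* Rows are treated from the bottom up: once the rows below [a] are known, only the diagonal term
     of row [a] of [M *m invmx M] survives. *)
  move: a; suff h k (a : 'I_n) : (n - a <= k)%N -> (b < a)%N -> invmx M a b = 0.
    by move=> a; apply: (h n); rewrite leq_subr.
  elim: k a => [|k IHk] a ak ba; first by have := ltn_ord a; lia.
  have : (M *m invmx M) a b = 0.
    by rewrite mulmxV // mxE -val_eqE /= gtn_eqF.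
  rewrite mxE (bigD1 a) //= big1 ?addr0 => [/eqP|c ca].
    by rewrite mulf_eq0 gt_eqF //= => /eqP.
  have [ca'|ac|/val_inj E] := ltngtP c a; last by rewrite E eqxx in ca.
    by rewrite M0 ?mul0r.
  by rewrite IHk ?mulr0 //; [have := ltn_ord c; lia | apply: ltn_trans ac].
apply/pos_upperP; split=> // a; have : (M *m invmx M) a a = 1 by rewrite mulmxV // mxE eqxx.
rewrite mxE (bigD1 a) //= big1 ?addr0 => [E|c ca].
  by rewrite -(pmulr_rgt0 _ (M1 a)) E.
have [ca'|ac|/val_inj E] := ltngtP c a; last by rewrite E eqxx in ca.
  by rewrite M0 ?mul0r.
by rewrite V0 ?mulr0.
Qed.

Record utri := Utri { utri_mx : 'M[R]_n; _ : pos_upper utri_mx }.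
HB.instance Definition _ := [isSub for utri_mx].
HB.instance Definition _ := [Choice of utri by <:].

Lemma utriP (g : utri) : pos_upper (utri_mx g). Proof. by case: g. Qed.

Definition utri1 := Utri pos_upper1.
Definition utri_mul (g h : utri) := Utri (pos_upperM (utriP g) (utriP h)).
Definition utri_inv (g : utri) := Utri (pos_upperV (utriP g)).

Lemma utri_mulA : associative utri_mul.
Proof. by move=> f g h; apply/val_inj; rewrite /= mulmxA. Qed.
Lemma utri_mul1 : left_id utri1 utri_mul.
Proof. by move=> f; apply/val_inj; rewrite /= mul1mx. Qed.
Lemma utri_mulr1 : right_id utri1 utri_mul.
Proof. by move=> f; apply/val_inj; rewrite /= mulmx1. Qed.
Lemma utri_mulV : left_inverse utri1 utri_inv utri_mul.
Proof. by move=> f; apply/val_inj; rewrite /= mulVmx // pos_upper_unit ?utriP. Qed.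
Lemma utri_mulrV : right_inverse utri1 utri_inv utri_mul.
Proof. by move=> f; apply/val_inj; rewrite /= mulmxV // pos_upper_unit ?utriP. Qed.

HB.instance Definition _ := isGroup.Build utri
  utri_mulA utri_mul1 utri_mulr1 utri_mulV utri_mulrV.

Lemma utri_mxM (g h : utri) : utri_mx (g * h)%g = utri_mx g *m utri_mx h.
Proof. by []. Qed.
Lemma utri_mxV (g : utri) : utri_mx g^-1%g = invmx (utri_mx g).
Proof. by []. Qed.
Lemma utri_mx1 : utri_mx 1%g = 1%:M.
Proof. by []. Qed.

End UpperTriangular.

(* Entries are compared column by column, each column read upwards from the
   diagonal: the first entry at which two matrices differ is then only scaled by
   diagonal entries when both are multiplied by a third one. *)
Lemma utri_bi_orderable (R : realFieldType) n : bi_orderable (utri R n.+1).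
Proof.
pose row p : 'I_n.+1 := rev_ord (inord (p %% n.+1)).
pose col p : 'I_n.+1 := inord (p %/ n.+1).
(* Coordinates past the last entry are constantly 0 and so never decide a comparison. *)
pose coord p (g : utri R n.+1) : R :=
  if (p < n.+1 * n.+1)%N then utri_mx g (row p) (col p) else 0%R.
pose pos (a b : 'I_n.+1) := (b * n.+1 + rev_ord a)%N.
have pos_lt a b : (pos a b < n.+1 * n.+1)%N.
  rewrite /pos (leq_trans (n := b.+1 * n.+1)) ?leq_mul2r //; last by rewrite ltn_ord orbT.
  by rewrite mulSn addnC ltn_add2r ltn_ord.
have posr a b : row (pos a b) = a.
  rewrite /row /pos modnMDl modn_small ?ltn_ord //.
  by rewrite inord_val rev_ordK.
have posc a b : col (pos a b) = b.
  by rewrite /col /pos divnMDl // divn_small ?ltn_ord // addn0 inord_val.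
have posK p : (p < n.+1 * n.+1)%N -> pos (row p) (col p) = p.
  move=> pn; rewrite /pos rev_ordK /col !inordK ?ltn_mod ?ltn_divLR //.
  by rewrite -divn_eq.
have pos_lt2 (a b c : 'I_n.+1) : (a < c)%N -> (pos c b < pos a b)%N.
  by have := ltn_ord c; rewrite /pos /= !subSS; lia.
have pos_lt1 (a b c : 'I_n.+1) : (c < b)%N -> (pos a c < pos a b)%N.
  by move=> cb; rewrite /pos ltn_add2r ltn_mul2r.
have coordE a b g : coord (pos a b) g = utri_mx g a b.
  by rewrite /coord pos_lt posr posc.
apply: (@lex_bi_orderable _ (fun _ => R) (fun _ => <%R) coord).
- by move=> p x; rewrite ltxx.
- by move=> p; exact: lt_trans.
- by move=> p x y; rewrite neq_lt.
- move=> u v E; apply/val_inj/matrixP => a b.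
  by rewrite -!coordE E.
move=> p u v g E; have [pn|pn] := ltnP p (n.+1 * n.+1); last first.
  by rewrite /coord ltnNge pn ltxx.
move: E; rewrite -(posK p pn); set a := row p; set b := col p => E.
rewrite !coordE -subr_gt0 => uv.
have Ep c d : (pos c d < pos a b)%N -> (utri_mx v - utri_mx u)%R c d = 0%R.
  by move=> /E; rewrite !coordE !mxE => ->; rewrite subrr.
have /pos_upperP[g1 g0] := utriP g.
rewrite -(subr_gt0 (utri_mx (u * g)%g a b)) -(subr_gt0 (utri_mx (g * u)%g a b)).
have -> : (utri_mx (v * g)%g a b - utri_mx (u * g)%g a b)%R =
    ((utri_mx v - utri_mx u) *m utri_mx g)%R a b.
  by rewrite mulmxBl !mxE.
have -> : (utri_mx (g * v)%g a b - utri_mx (g * u)%g a b)%R =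
    (utri_mx g *m (utri_mx v - utri_mx u))%R a b.
  by rewrite mulmxBr !mxE.
have uvab : (0 < (utri_mx v - utri_mx u)%R a b)%R by rewrite !mxE.
split; rewrite mxE.
  rewrite (bigD1 b) //= big1 ?addr0 ?mulr_gt0 // => c cb.
  have [cb'|bc|/val_inj Ec] := ltngtP c b; last by rewrite Ec eqxx in cb.
    by rewrite Ep ?mul0r ?pos_lt1.
  by rewrite g0 ?mulr0.
rewrite (bigD1 a) //= big1 ?addr0 ?mulr_gt0 // => c ca.
have [ca'|ac|/val_inj Ec] := ltngtP c a; last by rewrite Ec eqxx in ca.
  by rewrite g0 ?mul0r.
by rewrite Ep ?mulr0 ?pos_lt2.
Qed.

(** * Words, presentations and the ascending form of the group *)

Section Evaluation.
Local Open Scope group_scope.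
Variables (T : choiceType) (H : groupType) (g : T -> H).
Implicit Types (l : T * bool) (s : seq (T * bool)).

Definition letter_val l : H := if l.2 then g l.1 else (g l.1)^-1.
Definition word_val s : H := \prod_(l <- s) letter_val l.

Lemma word_val_nil : word_val [::] = 1. Proof. exact: big_nil. Qed.

Lemma word_val_cons l s : word_val (l :: s) = letter_val l * word_val s.
Proof. exact: big_cons. Qed.

Lemma word_val_cat s1 s2 : word_val (s1 ++ s2) = word_val s1 * word_val s2.
Proof. exact: big_cat. Qed.

Lemma letter_val_inv l : letter_val (inv_letter l) = (letter_val l)^-1.
Proof. by case: l => a [] //=; rewrite /letter_val /= invgK. Qed.

Lemma word_val_push l s : word_val (push l s) = letter_val l * word_val s.
Proof.
case: s => [|k s] /=; first by rewrite word_val_cons.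
case: eqP => [->|_]; last by rewrite word_val_cons.
by rewrite word_val_cons letter_val_inv mulVKg.
Qed.

Lemma word_val_reduce s1 s2 : word_val (reduce_cat s1 s2) = word_val s1 * word_val s2.
Proof.
elim: s1 => [|l s1 IHs] /=; first by rewrite word_val_nil mul1g.
by rewrite word_val_push IHs word_val_cons mulgA.
Qed.

Lemma word_val_inv s : word_val (inv_word s) = (word_val s)^-1.
Proof.
elim: s => [|l s IHs]; first by rewrite word_val_nil invg1.
rewrite /inv_word /= rev_cons -cats1 word_val_cat -/(inv_word s) IHs.
by rewrite !word_val_cons word_val_nil mulg1 invgM letter_val_inv.
Qed.

Lemma free_word_valM :
  {morph (fun u : free_group T => word_val (free_word u)) : u v / u * v}.
Proof. by move=> u v; rewrite word_val_reduce. Qed.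

End Evaluation.

Lemma morph_word_val (T : choiceType) (H H' : groupType) (h : H -> H')
    (g : T -> H) s : {morph h : u v / (u * v)%g} ->
  h (word_val g s) = word_val (h \o g) s.
Proof.
move=> hM; rewrite /word_val (morph_prod hM); apply: eq_bigr => l _.
by rewrite /letter_val; case: l.2; rewrite ?(morph_inv hM).
Qed.

Lemma eq_word_val (T : choiceType) (H : groupType) (g g' : T -> H) s :
  (forall l, l \in s -> g l.1 = g' l.1) -> word_val g s = word_val g' s.
Proof.
by move=> E; apply: eq_big_seq => l /E; rewrite /letter_val; case: l.2 => /= ->.
Qed.

Lemma free_word_val (T : choiceType) (u : free_group T) :
  u = word_val (@free_gen T) (free_word u).
Proof.
case: u => s sR /=; apply/val_inj => /=.
elim: s sR => [|l s IHs] sR; first by rewrite word_val_nil.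
rewrite word_val_cons; have sR' : reduced s by apply: path_sorted sR.
have -> : free_word (letter_val (@free_gen T) l * word_val (@free_gen T) s)%g =
    push l (free_word (word_val (@free_gen T) s)).
  by case: l {sR} => a [].
by rewrite -IHs //; case: s sR {IHs sR'} => //= k s /andP[/negPf->].
Qed.

Lemma free_morph_word_val (T : choiceType) (H : groupType) (f : free_group T -> H) u :
  {morph f : u v / (u * v)%g} -> f u = word_val (f \o @free_gen T) (free_word u).
Proof. by move=> fM; rewrite {1}(free_word_val u) morph_word_val. Qed.

Lemma push_subset (T : choiceType) (l : T * bool) s : {subset push l s <= l :: s}.
Proof.
case: s => [|k s] //= x; case: ifP => // _ xs; by rewrite !inE xs !orbT.
Qed.

Lemma reduce_subset (T : choiceType) (s : seq (T * bool)) :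
  {subset reduce_cat s [::] <= s}.
Proof.
elim: s => //= l s IHs x /push_subset; rewrite !inE => /orP[->//|/IHs->].
by rewrite orbT.
Qed.

(** The universal property of a presentation: [k] is [h] composed with a set-theoretic section of
    [f], well defined because the kernel of [h] is a normal subgroup containing the relators. *)
Lemma presentation_factor (T : choiceType) (rels : set (free_group T))
    (G H : groupType) (f : free_group T -> G) (h : free_group T -> H) :
  {morph f : u v / (u * v)%g} -> {morph h : u v / (u * v)%g} ->
  (forall g, exists u, f u = g) ->
  (forall u, f u = 1%g <-> normal_closure rels u) ->
  (forall u, rels u -> h u = 1%g) ->
  exists2 k : G -> H, {morph k : u v / (u * v)%g} & forall u, k (f u) = h u.
Proof.
move=> fM hM /choice[sec fsec] ker hrels.
have hker u : f u = 1%g -> h u = 1%g.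
  move/ker => /(_ [set v | h v = 1%g]%classic); apply; split=> //; split.
    split=> [|v v' /= hv hv']; first exact: morph_one.
    by rewrite hM (morph_inv hM) hv hv' mulgV.
  by move=> v v' /= hv'; rewrite (morph_conj hM) hv' conj1g.
have kf u : h (sec (f u)) = h u.
  apply: divg1_eq; rewrite -(morph_inv hM) -hM; apply: hker.
  by rewrite fM (morph_inv fM) fsec mulgV.
exists (h \o sec) => //= u v.
by rewrite -hM -[RHS]kf fM !fsec.
Qed.

(** * The normal form in an ascending HNN extension *)

Section AscendingForm.
Local Open Scope group_scope.
Variables (G : groupType) (x t : G) (K : nat) (sW : seq (nat * bool)).
Let X i := x ^ (t ^+ i).
Let good (s : seq (nat * bool)) := all (fun l => l.1 < K)%N s.
Hypothesis sW_good : good sW.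
Hypothesis sWE : X K = word_val X sW.

Let good_inv s : good s -> good (inv_word s).
Proof. by rewrite /good /inv_word all_rev all_map. Qed.

(** Conjugation by [t] raises every index by one; an index that reaches [K] is replaced by the word
    [sW]. *)
Let conj_t s : good s -> exists2 s', good s' & word_val X s ^ t = word_val X s'.
Proof.
elim: s => [|[i b] s IHs] /=; first by exists [::]; rewrite // word_val_nil conj1g.
move=> /andP[/= iK /IHs[s' s'good E]].
have [s1 s1good E1] : exists2 s1, good s1 & X i ^ t = word_val X s1.
  rewrite /X -conjgM -expgSr; case: (ltngtP i.+1 K) => [iK'|iK'|->].
  - exists [:: (i.+1, true)]; first by rewrite /good /= iK'.
    by rewrite word_val_cons word_val_nil mulg1.
  - by have := leq_trans iK' iK; rewrite ltnn.
  by exists sW.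
exists ((if b then s1 else inv_word s1) ++ s').
  by rewrite /good all_cat -!/(good _) s'good andbT; case: b; rewrite ?good_inv.
rewrite word_val_cons conjMg E word_val_cat; congr (_ * _).
by rewrite /letter_val; case: b; rewrite //= ?word_val_inv ?conjVg E1.
Qed.

Let X_word i : exists2 s, good s & X i = word_val X s.
Proof.
elim: i => [|i [s sgood E]].
  case: (posnP K) => [K0|K0]; first by exists sW; rewrite -?sWE ?K0.
  exists [:: (0%N, true)]; first by rewrite /good /= K0.
  by rewrite word_val_cons word_val_nil mulg1.
have [s' s'good E'] := conj_t sgood; exists s' => //.
by rewrite -E' -E /X expgSr conjgM.
Qed.

(** Letters are prefixed one at a time. A letter [x] passes [t ^+ a] by turning into [X a]; a letter
    [t^-1] either cancels against [t ^+ a] or, for [a = 0], moves to the right end by conjugating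
    the middle word. *)
Lemma ascending_form (s : seq (bool * bool)) :
  exists a b s', [/\ good s', reduced s' &
    word_val (fun c => if c then t else x) s = t ^+ a * word_val X s' * t ^- b].
Proof.
suff [a [b [s' [s'good E]]]] : exists a b s', good s' /\
    word_val (fun c => if c then t else x) s = t ^+ a * word_val X s' * t ^- b.
  exists a, b, (reduce_cat s' [::]); split.
  - by apply/allP => l /reduce_subset; exact: (allP s'good).
  - exact: reduce_cat_reduced.
  by rewrite word_val_reduce word_val_nil mulg1.
elim: s => [|[c e] s [a [b [s' [s'good E]]]]].
  by exists 0%N, 0%N, [::]; rewrite !word_val_nil !mulg1 invg1 mul1g.
rewrite word_val_cons {}E /letter_val /=; case: c e => [] [].
- by exists a.+1, b, s'; rewrite expgS !mulgA.
- case: a => [|a]; last by exists a, b, s'; rewrite expgS !mulgA mulVg mul1g.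
  have [s'' s''good E] := conj_t s'good; exists 0%N, b.+1, s''; split=> //.
  by rewrite -E conjgE expg0 !mul1g expgSr invgM !mulgA mulgK.
- have [s1 s1good E1] := X_word a; exists a, b, (s1 ++ s'); split.
    by rewrite /good all_cat -!/(good _) s1good.
  by rewrite word_val_cat -E1 /X conjgE !mulgA mulgV mul1g.
have [s1 s1good E1] := X_word a; exists a, b, (inv_word s1 ++ s'); split.
  by rewrite /good all_cat -!/(good _) good_inv.
by rewrite word_val_cat word_val_inv -E1 /X -conjVg conjgE !mulgA mulgV mul1g.
Qed.

End AscendingForm.

(** * Solving the relator for the generator of highest index *)

Section SolvedRelator.
Variables (R : comNzRingType) (r : nat) (m d : 'I_r -> int) (e : int).
Variables (dl : 'I_r -> nat) (k0 : 'I_r).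
Hypothesis dE : forall i, d i = ((dl i)%:Z + e)%R.
Hypothesis dl_lt : forall i, i != k0 -> (dl i < dl k0)%N.
Hypothesis m1 : m k0 = 1%R.

(** The abelianized word, with the generator of index [i] recorded as ['X^i]. *)
Definition lin_poly (s : seq (nat * bool)) : {poly R} :=
  (\sum_(l <- s) if l.2 then 'X^(l.1) else - 'X^(l.1))%R.

Let pow_word (j : nat) (i : int) := nseq `|i|%N (j, (0 <= i)%R).

Let word_val_pow (H : groupType) (g : nat -> H) j i :
  word_val g (pow_word j i) = expgz (g j) i.
Proof.
have E b k : word_val g (nseq k (j, b)) = (letter_val g (j, b) ^+ k)%g.
  elim: k => [|k IHk]; first by rewrite word_val_nil.
  by rewrite /= word_val_cons IHk -expgS.
by case: i => k; rewrite /pow_word E //= /letter_val /= expVgn.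
Qed.

Let lin_poly_pow j i : lin_poly (pow_word j i) = (i%:~R *: 'X^j)%R.
Proof.
have E b k : lin_poly (nseq k (j, b)) = ((if b then 'X^j else - 'X^j) *+ k)%R.
  elim: k => [|k IHk]; first by rewrite /lin_poly big_nil.
  by rewrite /lin_poly /= big_cons -/(lin_poly _) IHk mulrS.
case: i => k; rewrite /pow_word E /=.
  by rewrite -scaler_nat.
by rewrite NegzE mulrNz scaleNr -scaler_nat scalerN.
Qed.

Let lin_poly_cat s1 s2 : lin_poly (s1 ++ s2) = (lin_poly s1 + lin_poly s2)%R.
Proof. exact: big_cat. Qed.

Let lin_poly_inv s : lin_poly (inv_word s) = (- lin_poly s)%R.
Proof.
elim: s => [|l s IHs]; first by rewrite /lin_poly !big_nil oppr0.
rewrite /inv_word /= rev_cons -cats1 lin_poly_cat -/(inv_word s) IHs.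
rewrite /lin_poly !big_cons big_nil opprD addr0 addrC.
by case: l => j [] /=; rewrite ?opprK.
Qed.

Let expgz_shift (H : groupType) (t : H) k (i : int) :
  expgz t (k%:Z + i)%R = (t ^+ k * expgz t i)%g.
Proof.
case: i => [j|j] /=; first by rewrite -expgnDr.
rewrite NegzE; case: (leqP j.+1 k) => jk.
  by rewrite subzn // -expgnFr.
have -> : (k%:Z - j.+1%:Z)%R = Negz (j - k) by rewrite NegzE; lia.
have -> : j.+1 = ((j - k).+1 + k)%N by lia.
by rewrite /= expgnDr invgM mulVKg.
Qed.

(** Up to conjugation by a power of [t], the relator is a product in which the top generator occurs
    once, with exponent 1, between two words [W s1] and [W s2] in lower generators. It can thus be
    isolated, and [sW] is the product of the inverses of these words. *)
Lemma solved_relator : exists sW : seq (nat * bool),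
  [/\ all (fun l => l.1 < dl k0)%N sW,
      lin_poly sW = ('X^(dl k0) - \sum_(i < r) (m i)%:~R *: 'X^(dl i))%R
    & forall (H : groupType) (x t : H),
      (\prod_(i < r) (expgz x (m i)) ^ (expgz t (d i)) = 1)%g <->
      (x ^ (t ^+ dl k0) = word_val (fun i => x ^ (t ^+ i)) sW)%g].
Proof.
have : uniq (index_enum 'I_r) by apply: index_enum_uniq.
have := mem_index_enum k0.
case/splitPr: (index_enum 'I_r) / => [s1 s2].
rewrite cat_uniq /= => /and4P[_ /norP[k1 _] k2 _].
pose W s := flatten [seq pow_word (dl i) (m i) | i <- s].
have Wgood s : k0 \notin s -> all (fun l => l.1 < dl k0)%N (W s).
  move=> ks; apply/allP => l /flatten_mapP[i si /nseqP[-> _]] /=.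
  by apply: dl_lt; apply: contraNneq ks => <-.
have lW s : lin_poly (W s) = (\sum_(i <- s) (m i)%:~R *: 'X^(dl i))%R.
  elim: s => [|i s IHs]; first by rewrite /lin_poly !big_nil.
  by rewrite /W /= lin_poly_cat lin_poly_pow big_cons -IHs.
have vW (H : groupType) (g : nat -> H) s :
    word_val g (W s) = (\prod_(i <- s) expgz (g (dl i)) (m i))%g.
  elim: s => [|i s IHs]; first by rewrite word_val_nil big_nil.
  by rewrite /W /= word_val_cat word_val_pow big_cons -IHs.
exists (inv_word (W s1) ++ inv_word (W s2)); split.
- by rewrite all_cat /inv_word !all_rev !all_map; apply/andP; split; apply: Wgood.
- rewrite lin_poly_cat !lin_poly_inv !lW big_cat big_cons /= m1 scale1r.
  by rewrite !opprD addrCA addNKr.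
move=> H x t.
have -> : (\prod_(i <- s1 ++ k0 :: s2) (expgz x (m i)) ^ (expgz t (d i)))%g =
   ((\prod_(i <- s1 ++ k0 :: s2) expgz (x ^ (t ^+ dl i)) (m i)) ^ expgz t e)%g.
  rewrite conjg_prod; apply: eq_bigr => i _; rewrite dE expgz_shift conjgM.
  by rewrite (morph_expgz (h := fun y => (y ^ (t ^+ dl i))%g)) // => u v; rewrite conjMg.
rewrite word_val_cat !word_val_inv !vW big_cat big_cons m1 /=.
set u := (\prod_(i <- s1) _)%g; set v := (\prod_(i <- s2) _)%g.
split=> [/eqP|->]; last by rewrite -mulgA mulVg mulg1 mulgV conj1g.
rewrite conjg_eq1 => /eqP h.
by rewrite (mulg1_eq h) mulgK.
Qed.

End SolvedRelator.

(** * Coefficients of the Magnus expansion *)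

Section MagnusCoefficients.
Local Open Scope ring_scope.
Variable R : realDomainType.
Implicit Types (z : seq (nat * bool)) (l : seq nat).

Definition letter_sign (b : bool) : R := if b then 1 else -1.

(* If [x_i = 1 + y_i] and [z] is a word read from right to left, [mcoef z l] is
   the coefficient in [z] of the monomial with letters [l], also read from right
   to left, as long as no two consecutive letters of [l] are equal. *)
Fixpoint mcoef z l : R :=
  if z is (i, b) :: z' then
    mcoef z' l + (if l is j :: l' then (letter_sign b *+ (i == j)) * mcoef z' l' else 0)
  else (l == [::])%:R.

(** The monomial used in Magnus's argument, with one letter for each syllable of [z]; for reduced
    [z] its coefficient is the product of the syllable exponents. *)
Fixpoint collapse z : seq nat :=
  if z is (i, _) :: z' then
    if ohead (collapse z') == Some i then collapse z' else i :: collapse z'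
  else [::].

Definition alternating l := sorted (fun i j => i != j) l.

Lemma ohead_collapse i b z : ohead (collapse ((i, b) :: z)) = Some i.
Proof. by rewrite /=; case: eqP. Qed.

Lemma alternating_behead i l : alternating (i :: l) -> alternating l.
Proof. exact: path_sorted. Qed.

Lemma alternating_ohead i l : alternating (i :: l) -> ohead l != Some i.
Proof. by case: l => //= j l /andP[ij _]; rewrite eq_sym. Qed.

Lemma alternating_cons i l : alternating l -> ohead l != Some i -> alternating (i :: l).
Proof.
by case: l => //= j l h ji; rewrite /alternating /= eq_sym h andbT.
Qed.

Lemma alternating_collapse z : alternating (collapse z).
Proof.
elim: z => //= [[i b] z IHz]; case: ifPn => // hi; exact: alternating_cons.
Qed.

Lemma collapse_subset z : {subset collapse z <= map fst z}.
Proof.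
elim: z => //= [[i b] z IHz] j; rewrite [j \in i :: _]inE.
by case: ifP => _ => [/IHz->|]; rewrite ?orbT // inE => /orP[->|/IHz->] //; rewrite orbT.
Qed.

(** An alternating monomial takes at most one letter from each syllable. If its length is maximal,
    every syllable contributes, so the first letters agree. *)
Lemma mcoef_support z l : alternating l -> mcoef z l != 0 ->
  (size l <= size (collapse z))%N /\
  (size l = size (collapse z) -> ohead l = ohead (collapse z)).
Proof.
elim: z l => [|[i b] z IHz] l alt /=; first by case: l alt => [|j l] // _; rewrite eqxx.
move=> nz; have : mcoef z l != 0 \/
    exists2 l', l = i :: l' & mcoef z l' != 0.
  case: (eqVneq (mcoef z l) 0) nz => [->|]; last by left.
  rewrite add0r; case: l {alt} => [|j l']; first by rewrite eqxx.
  by case: (eqVneq i j) => [<-|_]; rewrite ?mulr0n ?mul0r ?eqxx // mulf_eq0 negb_or;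
    move=> /andP[_]; right; exists l'.
case=> [/(IHz l alt)[le eq]|[l' El]].
  by case: ifPn => // _ /=; split=> [|E]; [exact: leqW | move: le; rewrite E ltnn].
move: alt; rewrite {}El => alt /(IHz l' (alternating_behead alt))[le eq].
case: ifPn => [/eqP h|_] /=; last by [].
have lt : (size l' < size (collapse z))%N.
  rewrite ltn_neqAle le andbT; apply/eqP => /eq E.
  by have := alternating_ohead alt; rewrite E h eqxx.
by split.
Qed.

Lemma mcoef_skip i b z l : ohead l != Some i -> mcoef ((i, b) :: z) l = mcoef z l.
Proof.
case: l => [|j l] /=; first by rewrite addr0.
by case: (eqVneq i j) => [->|]; rewrite ?eqxx // mul0r addr0.
Qed.

Lemma mcoef_same i b z l :
  mcoef ((i, b) :: z) (i :: l) = mcoef z (i :: l) + letter_sign b * mcoef z l.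
Proof. by rewrite /= eqxx. Qed.

(* The sign of the product determines by induction the sign of the exponent of
   the outermost syllable, so that no cancellation occurs within a syllable. *)
Lemma mcoef_collapse_sign i b z : reduced ((i, b) :: z) ->
  0 < letter_sign b * mcoef ((i, b) :: z) (collapse ((i, b) :: z)) *
      mcoef ((i, b) :: z) (behead (collapse ((i, b) :: z))).
Proof.
have sgn c : letter_sign c * letter_sign c = 1.
  by case: c; rewrite /letter_sign ?mulrNN mulr1.
elim: z i b => [|[j c] z IHz] i b zR.
  by rewrite /= eqxx /= !mulr0n add0r !addr0 !mulr1 sgn.
have {}/IHz IHz : reduced ((j, c) :: z) by apply: path_sorted zR.
have hz := ohead_collapse j c z; move: (alternating_collapse ((j, c) :: z)).
rewrite {1}/collapse -/(collapse ((j, c) :: z)).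
set k := collapse ((j, c) :: z) in IHz hz *.
have -> : collapse [:: (i, b), (j, c) & z] = if ohead k == Some i then k else i :: k by [].
rewrite hz; move=> altk; case: eqP => [[ji]|/eqP ji].
- subst j; have cb : c = b.
    by move: zR => /= /andP[]; rewrite /inv_letter /= xpair_eqE eqxx /=; case: b c {IHz hz altk k} => [] [].
  subst c; case: k hz IHz altk => // h q [->] IHz altk {h}.
  rewrite [behead _]/= in IHz *; rewrite mcoef_same (@mcoef_skip i b ((i, b) :: z) q) ?alternating_ohead //.
  set u := mcoef _ (i :: q) in IHz *; set v := mcoef _ q in IHz *.
  clearbody u v; rewrite mulrDr mulrA sgn mul1r mulrDl addr_gt0 //.
  rewrite -expr2 exprn_even_gt0 //=; apply: contraTneq IHz => ->.
  by rewrite mulr0 ltxx.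
have ki : ohead k != Some i by rewrite hz.
rewrite [behead _]/= mcoef_same (@mcoef_skip i b ((j, c) :: z) k) //.
have nz : mcoef ((j, c) :: z) k != 0.
  by apply: contraTneq IHz => ->; rewrite mulr0 mul0r ltxx.
have -> : mcoef ((j, c) :: z) (i :: k) = 0.
  apply: contraTeq isT => /mcoef_support => /(_ (alternating_cons altk ki))[].
  by rewrite /= -/k ltnn.
by rewrite add0r mulrA sgn mul1r -expr2 exprn_even_gt0.
Qed.

Lemma mcoef_faithful z : reduced z -> z != [::] ->
  mcoef z (collapse z) != 0 /\ collapse z != [::].
Proof.
case: z => // [[i b] z] zR _; split; last first.
  by have := ohead_collapse i b z; case: collapse.
by apply: contraTneq (mcoef_collapse_sign zR) => ->; rewrite mulr0 mul0r ltxx.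
Qed.

End MagnusCoefficients.

(** * Matrices acting on words *)

Section ShiftMatrices.
Local Open Scope ring_scope.
Variables (R : realFieldType) (N n : nat).
Hypothesis N_gt0 : (0 < N)%N.
Implicit Types M P : 'M[R]_n.+1.

(* Indices encode words over the alphabet [0 .. N-1]: the word with first letter
   [j] followed by the word encoded by [a] is encoded by [N * a + j + 1], and [0]
   encodes the empty word. *)
Definition shift j : 'M[R]_n.+1 := \matrix_(a, b) (b == N * a + j.+1 :> nat)%N%:R.

(** Row [a] starts at column [N * a + s]: for [s = j.+1] this is the word [a] with [j] put in front,
    while [s = N.+1] lies past all one-letter extensions of [a]. *)
Definition order_ge s M := forall a b : 'I_n.+1, (b < N * a + s)%N -> M a b = 0.

Lemma order_ge_le s s' M : (s' <= s)%N -> order_ge s M -> order_ge s' M.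
Proof. by move=> ss' h a b ba; rewrite h // (leq_trans ba) ?leq_add2l. Qed.

Lemma order_geD s M P : order_ge s M -> order_ge s P -> order_ge s (M + P).
Proof. by move=> h h' a b ba; rewrite mxE h ?h' ?addr0. Qed.

Lemma order_geZ s c M : order_ge s M -> order_ge s (c *: M).
Proof. by move=> h a b ba; rewrite mxE h ?mulr0. Qed.

Lemma order_ge_sum s I (r : seq I) (F : I -> 'M[R]_n.+1) :
  (forall i, order_ge s (F i)) -> order_ge s (\sum_(i <- r) F i).
Proof.
move=> h; apply: big_ind => [a b _|M P|i _]; rewrite ?mxE //; exact: order_geD.
Qed.

Lemma order_geM M P : order_ge 1 M -> order_ge 1 P -> order_ge N.+1 (M *m P).
Proof.
move=> h h' a b ba; rewrite mxE big1 // => c _.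
have [ca|ca] := ltnP c (N * a + 1); first by rewrite h ?mul0r.
rewrite h' ?mulr0 //; apply: leq_trans ba _.
have : (N * (N * a + 1) <= N * c)%N by rewrite leq_mul2l ca orbT.
by have : (a <= N * a)%N; [rewrite leq_pmull | nia].
Qed.

Lemma order_geM_upper M P : order_ge 1 M -> pos_upper P -> order_ge 1 (M *m P).
Proof.
move=> h /pos_upperP[_ P0] a b ba; rewrite mxE big1 // => c _.
have [ca|ca] := ltnP c (N * a + 1); first by rewrite h ?mul0r.
by rewrite P0 ?mulr0 // (leq_trans ba).
Qed.

Lemma order_ge_pos_upper M : order_ge 1 M -> pos_upper (1%:M + M).
Proof.
move=> h; have le a : (a <= N * a)%N by rewrite leq_pmull.
apply/pos_upperP; split=> [a|a b ba].
  by rewrite !mxE eqxx h ?addr0 ?ltr01 // addn1 ltnS.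
rewrite !mxE h ?addr0; last by rewrite addn1 ltnS (leq_trans (ltnW ba)).
by rewrite -val_eqE /= gtn_eqF.
Qed.

Lemma order_ge_shift j : order_ge j.+1 (shift j).
Proof. by move=> a b ba; rewrite mxE ltn_eqF. Qed.

Section Intertwiner.
Variables (phi : nat -> 'M[R]_n.+1) (c0 : R).
Hypothesis c0_gt0 : 0 < c0.
Hypothesis phi_order : forall j, (j < N)%N -> order_ge j.+1 (phi j).
Hypothesis phi_lead : forall j (a b : 'I_n.+1), (j < N)%N ->
  b = (N * a + j.+1)%N :> nat -> 0 < phi j a b.

(* [twrow_rec k p] is row [p] of the intertwiner, for any fuel [k > p]. *)
Fixpoint twrow_rec k p : 'rV[R]_n.+1 :=
  if k is k'.+1 then
    if p is q.+1 then twrow_rec k' (q %/ N)%N *m phi (q %% N)%N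
    else c0 *: delta_mx 0 0
  else 0.

Let twrow p := twrow_rec p.+1 p.

Let twrow_rec_fuel k p : (p < k)%N -> twrow_rec k p = twrow p.
Proof.
rewrite /twrow; elim/ltn_ind: p k => [] [|p] IHp [|k] //= pk.
have lt : (p %/ N < p.+1)%N by rewrite ltnS leq_div.
have lt' : (p %/ N < k)%N := leq_ltn_trans (leq_div p N) pk.
by rewrite (IHp _ lt k lt') -(IHp _ lt p.+1 lt).
Qed.

Let twrow0 : twrow 0 = c0 *: delta_mx 0 0. Proof. by []. Qed.

Let twrowS a j : (j < N)%N -> twrow (N * a + j.+1) = twrow a *m phi j.
Proof.
move=> jN; rewrite addnS {1}/twrow /= mulnC divnMDl // modnMDl modn_small //.
rewrite divn_small // addn0 -(twrow_rec_fuel (k := (a * N + j).+1)) // ltnS.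
by rewrite (leq_trans _ (leq_addr _ _)) // leq_pmulr.
Qed.

Let twrow_upper p (b : 'I_n.+1) :
  ((b < p)%N -> twrow p 0 b = 0) /\ (b = p :> nat -> 0 < twrow p 0 b).
Proof.
elim/ltn_ind: p b => [] [|p] IHp b.
  split=> // b0; have -> : b = 0 by apply: val_inj.
  by rewrite twrow0 !mxE /= mulr1.
have jN : (p %% N < N)%N by rewrite ltn_mod.
have pE : p.+1 = (N * (p %/ N)%N + (p %% N).+1)%N by rewrite addnS mulnC -divn_eq.
have {}IHp := IHp (p %/ N)%N (leq_div _ _).
rewrite pE twrowS // mxE; split=> [bp|bp].
  rewrite big1 // => c _; have [cp|pc] := ltnP c (p %/ N)%N.
    by rewrite (IHp c).1 ?mul0r.
  rewrite phi_order ?mulr0 // (leq_trans bp) // leq_add2r leq_mul2l pc orbT //.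
have pn : (p %/ N < n.+1)%N.
  apply: leq_trans (ltn_ord b); rewrite bp ltnS addnS.
  by rewrite (leq_trans (leq_pmull _ N_gt0)) // -addnS leq_addr.
rewrite (bigD1 (Ordinal pn)) //= big1 ?addr0 => [|c cp].
  by rewrite mulr_gt0 ?(IHp (Ordinal pn)).2 // phi_lead.
have [cp'|pc|/= E] := ltngtP c (p %/ N)%N.
- by rewrite (IHp c).1 ?mul0r.
- rewrite phi_order ?mulr0 // bp ltn_add2r ltn_mul2l N_gt0 //.
by case/eqP: cp; apply: val_inj.
Qed.

(** The relation for [j] says that row [N * a + j.+1] of [P] is row [a] times [phi j]. Together with
    row 0 this determines [P] recursively. *)
Lemma shift_intertwiner : exists P, [/\ pos_upper P, P 0 0 = c0
  & forall j, (j < N)%N -> shift j *m P = P *m phi j].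
Proof.
exists (\matrix_a twrow a); split.
- apply/pos_upperP; split=> [a|a b ba]; rewrite mxE; first exact: (twrow_upper a a).2.
  exact: (twrow_upper a b).1.
- by rewrite mxE twrow0 !mxE /= mulr1.
move=> j jN; apply/matrixP => a b.
have -> : ((\matrix_a twrow a) *m phi j) a b = twrow (N * a + j.+1) 0 b.
  by rewrite twrowS // !mxE; apply: eq_bigr => c _; rewrite mxE.
rewrite mxE; have [lt|le] := ltnP (N * a + j.+1)%N n.+1.
  rewrite (bigD1 (Ordinal lt)) //= big1 ?addr0 => [|c cE].
    by rewrite !mxE eqxx mul1r.
  by rewrite !mxE (_ : (_ == _ :> nat) = false) ?mul0r //; apply: contraNF cE.
(* Here the word is too long for the truncation: row [a] of [shift j] is zero, and by triangularity
   so is the row given by the recursion. *)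
rewrite big1 => [|c _]; first by rewrite (twrow_upper _ b).1 // (leq_trans (ltn_ord b)).
by rewrite mxE ltn_eqF ?mul0r // (leq_trans (ltn_ord c)).
Qed.

End Intertwiner.

(** Modulo products of two terms of order 1, the linear parts of the letters add up. *)
Lemma word_val_lin (g : nat -> utri R n.+1) (Y : nat -> 'M[R]_n.+1) s :
  (forall i, utri_mx (g i) = 1%:M + Y i) -> (forall i, order_ge 1 (Y i)) ->
  order_ge N.+1 (utri_mx (word_val g s) - 1%:M
                 - \sum_(l <- s) (letter_sign R l.2 *: Y l.1)).
Proof.
move=> gE Y1.
pose Z (l : nat * bool) := letter_sign R l.2 *: Y l.1.
have Z1 l : order_ge 1 (Z l) by exact: order_geZ.
have letter l : order_ge N.+1 (utri_mx (letter_val g l) - 1%:M - Z l).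
  case: l => i []; rewrite /Z /letter_val /=.
    by rewrite scale1r gE -addrA -opprD subrr => a b _; rewrite mxE.
  set V := invmx _; have Vu : pos_upper V by rewrite pos_upperV ?utriP.
  (* Substituting this identity for the inverse into itself shows that [V] is [1 - Y i] up to a
     second-order term. *)
  have EV : V = 1%:M - Y i *m V.
    have : utri_mx (g i) *m V = 1%:M by rewrite mulmxV // pos_upper_unit ?utriP.
    by rewrite {1}gE mulmxDl mul1mx => <-; rewrite addrK.
  have -> : V - 1%:M - -1 *: Y i = Y i *m (Y i *m V).
    rewrite {1}EV [X in _ = _ *m X](_ : _ = 1%:M - V); last by rewrite {2}EV opprB addrC subrK.
    rewrite mulmxBr mulmx1; move: (Y i *m V) => YV.
    by apply/matrixP => a b; rewrite !mxE; ring.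
  exact/order_geM/order_geM_upper.
elim: s => [|l s IHs]; first by rewrite word_val_nil big_nil subr0 subrr => a b _; rewrite mxE.
rewrite word_val_cons utri_mxM big_cons -/(Z l).
set w := utri_mx (word_val g s) in IHs *; set u := utri_mx (letter_val g l).
set S := \sum_(_ <- _) _ in IHs *.
have u1 : order_ge 1 (u - 1%:M).
  rewrite -[u - _](subrK (Z l)); apply: order_geD => //.
  exact: order_ge_le (letter l).
have w1 : order_ge 1 (w - 1%:M).
  rewrite -[w - _](subrK S); apply: order_geD; first exact: order_ge_le IHs.
  by apply: order_ge_sum => k; exact: Z1.
have -> : u *m w - 1%:M - (Z l + S) =
    (u - 1%:M) *m (w - 1%:M) + (u - 1%:M - Z l) + (w - 1%:M - S).
  rewrite mulmxBl !mulmxBr !mulmx1 !mul1mx; move: (u *m w) => uw.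
  apply/matrixP => a b; rewrite !mxE; ring.
by apply: order_geD IHs; apply: order_geD (letter l); exact: order_geM u1 w1.
Qed.

End ShiftMatrices.

(** * The triangular representation *)

Section NewtonCoordinates.
Local Open Scope ring_scope.
Variables (R : realFieldType) (lam : seq R).
Let K := size lam.
Let mu j := nth 1 lam j.
Let newton l : {poly R} := \prod_(i < l) ('X - (mu i)%:P).

(* The matrix of multiplication by ['X] in the Newton basis
   [newton 0, .., newton K], truncated. *)
Definition newton_mx : 'M[R]_K.+1 :=
  \matrix_(i, j) ((i == j)%:R * mu i + (j == i.+1 :> nat)%:R).

(** Row 0 stands for the polynomial 1, so row 0 of [p] evaluated at the matrix lists the Newton
    coordinates of [p]. Truncation is reduction modulo [newton K.+1], which leaves the coordinates
    up to [K] unchanged. *)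
Definition ncoord (p : {poly R}) j : R := horner_mx newton_mx p 0 (inord j).

Lemma ncoordB p q j : ncoord (p - q) j = ncoord p j - ncoord q j.
Proof. by rewrite /ncoord rmorphB !mxE. Qed.

Lemma ncoordZ c p j : ncoord (c *: p) j = c * ncoord p j.
Proof. by rewrite /ncoord linearZ !mxE. Qed.

Lemma ncoord_mulX p j : (j <= K)%N ->
  ncoord (p * 'X) j = ncoord p j * mu j + (if j is i.+1 then ncoord p i else 0).
Proof.
move=> jK; rewrite /ncoord rmorphM /= horner_mx_X mxE.
have E (c : 'I_K.+1) : newton_mx c (inord j) =
    (c == inord j)%:R * mu j + (j == c.+1 :> nat)%:R.
  by rewrite mxE inordK //; case: eqP => [->|]; rewrite ?inordK // !mul0r.
under eq_bigr do rewrite E mulrDr.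
rewrite big_split /= (bigD1 (inord j)) //= big1 ?addr0 => [|c /negPf->]; last first.
  by rewrite mul0r mulr0.
rewrite eqxx mul1r; congr (_ + _); case: j jK {E} => [|i] iK.
  by rewrite big1 // => c _; rewrite mulr0.
rewrite (bigD1 (inord i)) //= big1 ?addr0 => [|c ci].
  by rewrite inordK ?eqxx ?mulr1 // ltnW.
rewrite (_ : (_ == _ :> nat) = false) ?mulr0 //; apply: contraNF ci.
by rewrite eqSS => /eqP->; rewrite inord_val.
Qed.

Lemma ncoord1 j : (j <= K)%N -> ncoord 1 j = (j == 0)%:R.
Proof.
move=> jK; rewrite /ncoord rmorph1 mxE; congr (_%:R).
by rewrite -val_eqE /= inordK // eq_sym.
Qed.

Lemma ncoord_newton l j : (j <= K)%N -> ncoord (newton l) j = (j == l)%:R.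
Proof.
elim: l j => [|l IHl] j jK; first by rewrite /newton big_ord0 ncoord1.
have -> : newton l.+1 = newton l * ('X - (mu l)%:P) by rewrite /newton big_ord_recr.
rewrite mulrBr ncoordB ncoord_mulX //.
rewrite [newton l * _]mulrC mul_polyC ncoordZ IHl //.
case: j jK => [|j] jK.
  by case: (eqVneq 0%N l) => [<-|_]; rewrite /= ?mulr1n ?mulr0n; ring.
rewrite IHl 1?ltnW // eqSS.
by case: (eqVneq j.+1 l) => [<-|_]; rewrite /= ?mulr1n ?mulr0n; ring.
Qed.

Lemma ncoord_roots j : (j < K)%N -> ncoord (\prod_(z <- lam) ('X - z%:P)) j = 0.
Proof.
move=> jK; have -> : \prod_(z <- lam) ('X - z%:P) = newton K.
  by rewrite (big_nth 1) big_mkord.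
by rewrite ncoord_newton ?ltn_eqF // ltnW.
Qed.

Lemma ncoordXn i j : (i <= j <= K)%N -> ncoord 'X^i j = (i == j)%:R.
Proof.
elim: i j => [|i IHi] j /andP[ij jK]; first by rewrite expr0 ncoord1 // eq_sym.
rewrite exprSr ncoord_mulX // IHi ?jK ?(ltnW ij) // (ltn_eqF ij) mul0r add0r.
case: j ij jK => // j ij jK; have ijK : (i <= j <= K)%N by apply/andP; split; [exact: ij|exact: ltnW].
by rewrite (IHi j ijK) eqSS.
Qed.

(** The passage from monomials to the Newton basis is unitriangular, and the columns of the inverse
    matrix give the dual vectors. *)
Lemma ncoord_dual : exists c : nat -> nat -> R, forall i l, (i < K)%N -> (l < K)%N ->
  \sum_(j < K) ncoord 'X^i j * c l j = (i == l)%:R.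
Proof.
pose C : 'M[R]_K.+1 := \matrix_(i, j) ncoord 'X^i j.
have Cu : C \in unitmx.
  rewrite unitmxE det_trig.
    rewrite big1 ?unitr1 // => i _; rewrite mxE ncoordXn ?eqxx // leqnn.
    by rewrite -ltnS ltn_ord.
  apply/is_trig_mxP => i j ij; rewrite mxE ncoordXn ?(ltn_eqF ij) //.
  by rewrite (ltnW ij) -ltnS ltn_ord.
exists (fun l j => invmx C (inord j) (inord l)) => i l iK lK.
have : (C *m invmx C) (inord i) (inord l) = (i == l)%:R.
  by rewrite mulmxV // mxE -val_eqE /= !inordK // ltnW.
rewrite mxE big_ord_recr /= mxE inordK; last exact: ltnW.
rewrite ncoordXn ?(ltnW iK) ?leqnn // (ltn_eqF iK) mul0r addr0 => <-.
apply: eq_bigr => j _; rewrite mxE inordK; last exact: ltnW.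
by congr (_ * invmx C _ _); apply: val_inj; rewrite /= inordK // ltnW ?ltnS.
Qed.

End NewtonCoordinates.

(** * Homomorphisms to triangular matrices *)

Section Representation.
Local Open Scope ring_scope.
Variables (R : realFieldType) (lam : seq R) (n : nat) (sW : seq (nat * bool)).
Let K := size lam.
Let mu j := nth 1 lam j.
Hypothesis lam_gt0 : forall z, z \in lam -> 0 < z.
Hypothesis sW_good : all (fun l => l.1 < K)%N sW.
Hypothesis sW_lin :
  lin_poly R sW = 'X^K - \prod_(z <- lam) ('X - z%:P).

(* The alphabet has a spare letter [K], so that it is nonempty even if [K = 0]; the
   default value [1] of [mu] makes [t] fix that letter. *)
Notation D := (shift R K.+1 n).

(** For [p = 'X^i] this is the operator [y_i]. Leaving out coordinate [K] amounts to reducing [p]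
    modulo the product of the ['X - z%:P]. *)
Definition lin_mx (p : {poly R}) : 'M[R]_n.+1 := \sum_(j < K) ncoord lam p j *: D j.

Lemma lin_mx_order p : order_ge K.+1 1 (lin_mx p).
Proof.
apply: order_ge_sum => j; apply/order_geZ/order_ge_le/order_ge_shift => //.
Qed.

Lemma lin_mxB p q : lin_mx (p - q) = lin_mx p - lin_mx q.
Proof.
by rewrite /lin_mx -sumrB; apply: eq_bigr => j _; rewrite ncoordB scalerBl.
Qed.

Lemma lin_mx0 : lin_mx 0 = 0.
Proof. by rewrite -(subrr 0) lin_mxB subrr. Qed.

Definition gen_utri i : utri R n.+1 :=
  Utri (order_ge_pos_upper (ltn0Sn K) (lin_mx_order 'X^i)).

Let W := word_val gen_utri sW.
Let H := utri_mx W - 1%:M - lin_mx 'X^K.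

Let lin_mxD p q : lin_mx (p + q) = lin_mx p + lin_mx q.
Proof.
by rewrite -[q in LHS]opprK -(sub0r q) lin_mxB lin_mxB lin_mx0 sub0r opprK.
Qed.

Let lin_mx_word s : \sum_(l <- s) letter_sign R l.2 *: lin_mx 'X^(l.1) = lin_mx (lin_poly R s).
Proof.
elim: s => [|[i b] s IHs]; first by rewrite /lin_poly !big_nil lin_mx0.
rewrite /lin_poly !big_cons -/(lin_poly R s) IHs lin_mxD; congr (_ + _).
by case: b; rewrite /letter_sign /= ?scale1r // -[- 'X^i]sub0r lin_mxB lin_mx0 sub0r scaleN1r.
Qed.

Let W_order : order_ge K.+1 K.+2 H.
Proof.
have := word_val_lin (ltn0Sn K) (g := gen_utri) sW (fun i => erefl)
  (fun i => lin_mx_order 'X^i).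
rewrite (lin_mx_word sW) sW_lin lin_mxB [lin_mx (\prod_(_ <- _) _)]big1 ?subr0 //.
by move=> j _; rewrite ncoord_roots ?scale0r.
Qed.

(** Multiplication by ['X] in Newton coordinates, with the nonlinear part [H] of [W] added at the
    last letter so that the last generator is sent to [W] itself. *)
Let phi j := mu j *: D j + (j.+1 < K)%:R *: D j.+1 + (j.+1 == K)%:R *: H.

Let phi_lead j (a b : 'I_n.+1) : (j < K.+1)%N ->
  b = (K.+1 * a + j.+1)%N :> nat -> 0 < phi j a b.
Proof.
move=> jK bE; have : H a b = 0 by apply: W_order; rewrite bE ltn_add2l ltnS.
rewrite /phi; move: H => M M0; rewrite !mxE M0 mulr0 addr0.
rewrite bE eqxx eqn_add2l eqSS (ltn_eqF (ltnSn j)) mulr0 addr0 mulr1.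
have [jK'|Kj] := ltnP j K; first exact/lam_gt0/mem_nth.
by rewrite /mu nth_default.
Qed.

Let phi_order j : (j < K.+1)%N -> order_ge K.+1 j.+1 (phi j).
Proof.
move=> jK; apply: order_geD; first apply: order_geD; apply: order_geZ.
- exact: order_ge_shift.
- exact: order_ge_le (@order_ge_shift _ _ _ _).
exact: order_ge_le (leqW jK) W_order.
Qed.

(** The term [H] enters through the coordinate [K - 1] of ['X^i], which for [i < K] is 1 if
    [i = K - 1] and 0 otherwise. *)
Let lin_mx_phi i : (i < K)%N ->
  \sum_(j < K) ncoord lam 'X^i j *: phi j = lin_mx 'X^(i.+1) + (i.+1 == K)%:R *: H.
Proof.
move=> iK; rewrite exprSr /lin_mx.
under eq_bigr do rewrite 2!scalerDr.
under [in RHS]eq_bigr do rewrite ncoord_mulX ?(ltnW (ltn_ord _)) // scalerDl.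
rewrite !big_split /= -!addrA; congr (_ + _).
  by apply: eq_bigr => j _; rewrite scalerA.
congr (_ + _).
  case E : K iK => [//|k] _.
  rewrite big_ord_recr big_ord_recl /= ltnn mulr0n !scale0r scaler0 addr0 add0r.
  by apply: eq_bigr => j _; rewrite ltnS ltn_ord scale1r.
case E : K iK => [//|k] ik; rewrite big_ord_recr /= big1 ?add0r => [|j _].
  rewrite eqxx scale1r eqSS.
  have [->|nik] := eqVneq i k; first by rewrite ncoordXn ?eqxx // leqnn -/K E leqnSn.
  by rewrite ncoordXn ?(negPf nik) // -ltnS ik -/K E leqnSn.
by rewrite eqSS (ltn_eqF (ltn_ord j)) scale0r scaler0.
Qed.

Lemma representation : exists x t : utri R n.+1,
  [/\ utri_mx x 0 0 = 1, utri_mx t 0 0 = 2,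
      forall i, (i < K)%N -> (x ^ (t ^+ i) = gen_utri i)%g
    & (x ^ (t ^+ K) = word_val gen_utri sW)%g].
Proof.
have [P [Pu P00 Pphi]] :=
  shift_intertwiner (ltn0Sn K) (ltr0Sn R 1) phi_order phi_lead.
pose t : utri R n.+1 := Utri Pu.
have step i : (i < K)%N -> utri_mx (gen_utri i ^ t)%g =
    1%:M + lin_mx 'X^(i.+1) + (i.+1 == K)%:R *: H.
  move=> iK; rewrite conjgE.
  (* After multiplication by [t] on the left, the claim follows from [D j *m P = P *m phi j], summed
     with the Newton coordinates of ['X^i]. *)
  apply: (can_inj (mulKmx (pos_upper_unit Pu))).
  rewrite utri_mxM utri_mxV mulKVmx ?pos_upper_unit // utri_mxM /=.
  rewrite mulmxDl mul1mx -addrA mulmxDr mulmx1 -lin_mx_phi //; congr (_ + _).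
  rewrite /lin_mx mulmx_suml mulmx_sumr; apply: eq_bigr => j _.
  by rewrite -scalemxAl -scalemxAr Pphi // ltnW ?ltnS ?ltn_ord.
have xE i : (i < K)%N -> (gen_utri 0 ^ (t ^+ i) = gen_utri i)%g.
  elim: i => [|i IHi] iK; first by rewrite expg0 conjg1.
  rewrite expgSr conjgM IHi ?(ltnW iK) //; apply: val_inj.
  by apply: (etrans (step i (ltnW iK))); rewrite (ltn_eqF iK) mulr0n scale0r addr0.
exists (gen_utri 0), t; split=> //.
  rewrite /= !mxE lin_mx_order ?addr0 //; by rewrite muln0.
case E : K => [|k].
  have sW0 : sW = [::] by case: sW sW_good => //= l s; rewrite E ltn0.
  rewrite expg0 conjg1 sW0 word_val_nil; apply: val_inj.
  by rewrite /= /lin_mx big1 ?addr0 // -/K E => -[].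
rewrite expgSr conjgM xE ?E //; apply: val_inj.
apply: (etrans (step k _)); rewrite ?E // -E eqxx mulr1n scale1r /H.
by rewrite addrCA addrK subrK.
Qed.

End Representation.
(** * Freeness *)

Section Freeness.
Local Open Scope ring_scope.
Variables (R : realFieldType) (lam : seq R).
Let K := size lam.

(** The number of words of length at most [p] over [K.+1] letters, hence the first index past
    them. *)
Fixpoint tensor_bound p := if p is p'.+1 then (K.+1 * tensor_bound p').+1 else 1%N.

Lemma tensor_bound_mono p : (tensor_bound p <= tensor_bound p.+1)%N.
Proof. by rewrite /= leqW // leq_pmull. Qed.

Section FixedSize.
Variable n : nat.
Notation D := (shift R K.+1 n).
Variable c : nat -> nat -> R.
Hypothesis c_dual : forall i l, (i < K)%N -> (l < K)%N ->
  \sum_(j < K) ncoord lam 'X^i j * c l j = (i == l)%:R.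

(* Tensor product of the vectors [c i] for [i] in [l], where the words of length
   [size l] index a basis of the tensor power. *)
Fixpoint tensor_col (l : seq nat) : 'cV[R]_n.+1 :=
  if l is i :: l' then \sum_(j < K) c i j *: ((D j)^T *m tensor_col l')
  else delta_mx 0 0.

Lemma tensor_col_support l (a : 'I_n.+1) :
  (tensor_bound (size l) <= a)%N -> tensor_col l a 0 = 0.
Proof.
elim: l a => [|i l IHl] a /= ba.
  by rewrite mxE -val_eqE /= gtn_eqF.
rewrite summxE big1 // => j _; rewrite !mxE big1 ?mulr0 // => b _.
have [lb|bl] := leqP (tensor_bound (size l)) b; first by rewrite IHl ?mulr0.
rewrite !mxE (_ : (_ == _ :> nat) = false) ?mul0r //; apply/negbTE/eqP => aE.
move: ba; rewrite leqNgt => /negP; apply; rewrite aE ltnS.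
have : (K.+1 * b.+1 <= K.+1 * tensor_bound (size l))%N by rewrite leq_mul2l bl orbT.
by have := ltn_ord j; rewrite mulnS; lia.
Qed.

Lemma shift_trmx_tensor j j' l : (j < K.+1)%N -> (j' < K.+1)%N ->
  (K.+1 * tensor_bound (size l) <= n)%N ->
  D j *m ((D j')^T *m tensor_col l) = (j == j')%:R *: tensor_col l.
Proof.
move=> jK j'K le; rewrite mulmxA; apply/matrixP => a e; rewrite (ord1 e) {e}.
have DDE b : (D j *m (D j')^T) a b =
    ((K.+1 * a + j.+1 < n.+1)%N && (a == b) && (j == j'))%:R.
  have inj : (K.+1 * a + j.+1 == K.+1 * b + j'.+1)%N = (a == b) && (j == j').
    rewrite -val_eqE /=; apply/eqP/andP => [E|[/eqP-> /eqP->] //].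
    have {}E : (a * K.+1 + j = b * K.+1 + j')%N by lia.
    have := congr1 (divn^~ K.+1) E; have := congr1 (modn^~ K.+1) E.
    by rewrite !modnMDl !divnMDl // !modn_small // !divn_small // !addn0 => -> ->.
  rewrite mxE; have [lt|ge] /= := ltnP (K.+1 * a + j.+1)%N n.+1.
    rewrite (bigD1 (Ordinal lt)) //= big1 ?addr0 => [|d dE].
      by rewrite !mxE eqxx mul1r /= inj.
    by rewrite !mxE (_ : (_ == _ :> nat) = false) ?mul0r //; apply: contraNF dE.
  by rewrite big1 // => d _; rewrite !mxE ltn_eqF ?mul0r // (leq_trans (ltn_ord d)).
rewrite mxE [RHS]mxE (bigD1 a) //= big1 ?addr0 => [|b ba].
  rewrite DDE eqxx andbT.
  have [la|al] := leqP (tensor_bound (size l)) a.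
    by rewrite tensor_col_support // !mulr0.
  have : (K.+1 * a.+1 <= K.+1 * tensor_bound (size l))%N by rewrite leq_mul2l al orbT.
  by move=> h; rewrite (_ : (_ < _)%N = true) //; move: h; rewrite mulnS; lia.
by rewrite DDE [a == b]eq_sym (negPf ba) andbF mul0r.
Qed.

(** The transposed shifts put a letter in front and the shifts remove it; the size bound excludes
    truncation, and duality of [c] gives the scalar. *)
Lemma lin_mx_tensor i i' l : (i < K)%N -> (i' < K)%N ->
  (K.+1 * tensor_bound (size l) <= n)%N ->
  lin_mx lam n 'X^i *m tensor_col (i' :: l) = (i == i')%:R *: tensor_col l.
Proof.
move=> iK i'K le; rewrite -c_dual // scaler_suml mulmx_suml.
apply: eq_bigr => j _; rewrite mulmx_sumr (bigD1 j) //= big1 ?addr0 => [|j' jj'].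
  rewrite -scalemxAl -scalemxAr shift_trmx_tensor ?(ltn_trans (ltn_ord j)) //.
  by rewrite eqxx scale1r scalerA.
rewrite -scalemxAl -scalemxAr shift_trmx_tensor ?(ltn_trans (ltn_ord _)) //.
by rewrite (_ : (j == j' :> nat) = false) ?scale0r ?scaler0 //; apply: contraNF jj'; rewrite eq_sym.
Qed.

Lemma lin_mx_tensor_nil p : lin_mx lam n p *m tensor_col [::] = 0.
Proof.
apply/matrixP => a b; rewrite mxE big1 ?mxE // => e _.
rewrite !mxE; case: eqP => [->|_]; last by rewrite mulr0.
by rewrite lin_mx_order ?mul0r // addn1.
Qed.

Lemma lin_mx_tensor_skip i l : (i < K)%N -> all (fun j => j < K)%N l ->
  (K.+1 * tensor_bound (size l) <= n)%N -> ohead l != Some i ->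
  lin_mx lam n 'X^i *m tensor_col l = 0.
Proof.
case: l => [|j l] iK; first by rewrite lin_mx_tensor_nil.
move=> /andP[jK _] le ji; rewrite lin_mx_tensor //.
  by rewrite (_ : (i == j) = false) ?scale0r //; apply: contraNF ji => /eqP->.
by apply: leq_trans le; rewrite leq_mul2l tensor_bound_mono orbT.
Qed.

(** On an alternating tensor [y_i] acts as zero when applied twice, so the inverse of [1 + y_i] acts
    as [1 - y_i]. *)
Lemma letter_val_tensor i b l : (i < K)%N -> all (fun j => j < K)%N l ->
  (K.+1 * tensor_bound (size l) <= n)%N -> alternating l ->
  utri_mx (letter_val (gen_utri lam n) (i, b)) *m tensor_col l =
  tensor_col l +
  (if l is j :: l' then (letter_sign R b *+ (i == j)) *: tensor_col l' else 0).
Proof.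
move=> iK lK le alt; set u := (X in _ = _ + X).
have Yu : lin_mx lam n 'X^i *m tensor_col l = letter_sign R b *: u.
  rewrite /u; case: l {u} lK le alt => [|j l] /= ; first by rewrite lin_mx_tensor_nil scaler0.
  move=> /andP[jK lK] le alt; rewrite -/(tensor_col (j :: l)) lin_mx_tensor //; last first.
    by apply: leq_trans le; rewrite leq_mul2l tensor_bound_mono orbT.
  rewrite scalerA; congr (_ *: _).
  by case: (i == j); case: b; rewrite /letter_sign ?mulr0n ?mulr1n ?mulr0 ?mulr1 ?mulrNN ?mulr1.
have YYu : lin_mx lam n 'X^i *m u = 0.
  rewrite /u; case: l {u Yu} lK le alt => [|j l] /=; first by rewrite mulmx0.
  move=> /andP[jK lK] le alt; rewrite -scalemxAr.
  have [E|_] := eqVneq i j; last by rewrite mulr0n scale0r.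
  subst j.
  rewrite lin_mx_tensor_skip ?scaler0 //; last first.
    exact: alternating_ohead alt.
  by apply: leq_trans le; rewrite leq_mul2l tensor_bound_mono orbT.
case: b @u Yu YYu => u Yu YYu; rewrite /letter_val /=.
  by rewrite mulmxDl mul1mx Yu /letter_sign scale1r.
apply: (can_inj (mulKmx (pos_upper_unit (utriP (gen_utri lam n i))))).
rewrite mulKVmx ?pos_upper_unit ?utriP //= mulmxDl mul1mx mulmxDr Yu YYu addr0.
by rewrite /letter_sign scaleN1r addrK.
Qed.

(** The letter next to the column acts first, whence the reversal. Entry 0 belongs to the empty word
    and vanishes on tensors of positive length. *)
Lemma word_val_tensor z l :
  all (fun k => k.1 < K)%N z -> all (fun j => j < K)%N l -> alternating l ->
  (K.+1 * tensor_bound (size l) <= n)%N ->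
  (utri_mx (word_val (gen_utri lam n) (rev z)) *m tensor_col l) 0 0 = mcoef R z l.
Proof.
elim: z l => [|[i b] z IHz] l /=.
  rewrite word_val_nil mul1mx => _; case: l => [|j l] /=; first by rewrite mxE.
  move=> _ _ _; rewrite summxE big1 // => e _; rewrite !mxE big1 ?mulr0 // => d _.
  by rewrite !mxE addnS mul0r.
move=> /andP[iK zK] lK alt le; rewrite rev_cons -cats1 word_val_cat word_val_cons.
rewrite word_val_nil mulg1 utri_mxM -mulmxA letter_val_tensor // mulmxDr mxE IHz //.
congr (_ + _); case: l lK alt le => [|j l] /=; first by rewrite mulmx0 mxE.
move=> /andP[jK lK] alt le; rewrite -scalemxAr mxE IHz ?(alternating_behead alt) //.
by apply: leq_trans le; rewrite leq_mul2l tensor_bound_mono orbT.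
Qed.

End FixedSize.

Lemma gen_utri_free s : reduced s -> all (fun k => k.1 < K)%N s ->
  (forall n, word_val (gen_utri lam n) s = 1%g) -> s = [::].
Proof.
move=> sR sK s1; apply/eqP/negPn/negP => s0.
have zR : reduced (rev s).
  rewrite /reduced rev_sorted; apply: sub_sorted sR => k l /=.
  by apply: contraNneq => ->; rewrite inv_letterK.
have [|nz l0] := mcoef_faithful R zR; first by rewrite -size_eq0 size_rev size_eq0.
have [c c_dual] := ncoord_dual lam.
set l := collapse (rev s) in nz l0.
have lK : all (fun j => j < K)%N l.
  apply/allP => j /collapse_subset /mapP[k kz ->].
  by apply: (allP sK); rewrite -mem_rev.
have alt : alternating l := alternating_collapse _.
(* The truncation is chosen large enough for the monomial [l]. There the identity gives coefficient
   0, since [l] is nonempty, while [s] gives a nonzero one. *)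
pose n := (K.+1 * tensor_bound (size l))%N; have le := leqnn n.
have := word_val_tensor c_dual (z := [::]) isT lK alt le.
rewrite word_val_nil -(s1 n) -[s]revK (word_val_tensor c_dual) //; last by rewrite all_rev.
by move=> /eqP; rewrite /= (negPf l0) (negPf nz).
Qed.

End Freeness.
(** * Bi-orderability *)

Section DiagonalEntry.
Local Open Scope ring_scope.
Variables (R : realFieldType) (n : nat) (a : 'I_n).
Implicit Types g h : utri R n.

Lemma utri_diagM g h : utri_mx (g * h)%g a a = utri_mx g a a * utri_mx h a a.
Proof. by rewrite pos_upper_diag ?utriP. Qed.

Lemma utri_diag_neq0 g : utri_mx g a a != 0.
Proof. by have /pos_upperP[g0 _] := utriP g; rewrite gt_eqF. Qed.

Lemma utri_diagV g : utri_mx g^-1%g a a = (utri_mx g a a)^-1.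
Proof.
apply: (mulfI (utri_diag_neq0 g)).
by rewrite -utri_diagM mulgV mulfV ?utri_diag_neq0 // utri_mx1 mxE eqxx.
Qed.

Lemma utri_diagX g k : utri_mx (g ^+ k)%g a a = utri_mx g a a ^+ k.
Proof.
elim: k => [|k IHk]; first by rewrite expg0 utri_mx1 mxE eqxx expr0.
by rewrite expgS utri_diagM IHk exprS.
Qed.

Lemma utri_diagJ g h : utri_mx (g ^ h)%g a a = utri_mx g a a.
Proof.
rewrite conjgE !utri_diagM utri_diagV mulrA [_^-1 * _]mulrC mulfVK //.
exact: utri_diag_neq0.
Qed.

Lemma utri_diag_word_val (T : choiceType) (g : T -> utri R n) s :
  (forall c, utri_mx (g c) a a = 1) -> utri_mx (word_val g s) a a = 1.
Proof.
move=> g1; elim: s => [|[c b] s IHs]; first by rewrite word_val_nil utri_mx1 mxE eqxx.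
rewrite word_val_cons utri_diagM IHs mulr1 /letter_val.
by case: b; rewrite ?utri_diagV g1 ?invr1.
Qed.

End DiagonalEntry.

(** The complex factorization has only real roots, so it descends along the injective coefficient
    embedding. *)
Lemma real_rooted_split (R : rcfType) (p : {poly R}) : p \is monic ->
  (forall z : R[i], root (map_poly (real_complex R) p) z ->
    complex.Im z = 0%R /\ (0 < complex.Re z)%R) ->
  exists lam : seq R, [/\ p = (\prod_(z <- lam) ('X - z%:P))%R,
    (size lam).+1 = size p & forall z, z \in lam -> (0 < z)%R].
Proof.
move=> p_monic p_roots.
have [s] := closed_field_poly_normal (map_poly (real_complex R) p).
rewrite (monicP _) ?map_monic // scale1r => Es.
have sE z : z \in s -> z = ((complex.Re z)%:C)%C /\ (0 < complex.Re z)%R.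
  move=> zs; have [] : complex.Im z = 0%R /\ (0 < complex.Re z)%R.
    by apply: p_roots; rewrite Es root_prod_XsubC.
  by case: z {zs} => u v /= ->.
have pE : p = (\prod_(z <- map (@complex.Re R) s) ('X - z%:P))%R.
  apply: (map_poly_inj (real_complex R)); rewrite Es rmorph_prod big_map.
  rewrite !big_seq; apply: eq_bigr => z /sE[zE _].
  by rewrite rmorphB /= map_polyX map_polyC /= -zE.
exists (map (@complex.Re R) s); split=> //.
  by rewrite [in RHS]pE size_prod_XsubC.
by move=> z /mapP[u /sE[_ u0] ->].
Qed.

Theorem theoremC (R : realType) (w : F2)
    (r : nat) (m d : 'I_r -> int) (G : groupType)
    (w_monic : monic_word m d w)
    (G_pres : has_presentation [set w]%classic G)
    (A_roots : forall z : R[i],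
       root (map_poly intr (A_poly m d)) z ->
       complex.Im z = 0%R /\ (0 < complex.Re z)%R) :
  bi_orderable G.
Proof.
case: w_monic => -[[[_ wE] _ _ tau0] tau1] m1.
set e := e_min m d in tau0; set dm := d_max m d in tau0 tau1 m1.
have /cards1P[k0 tauE] : #|tau d dm| == 1%N by rewrite tau1.
have {}m1 : m k0 = 1%R by apply: m1; rewrite tauE set11.
have dk0 : d k0 = dm by apply/eqP; have := set11 k0; rewrite -tauE inE.
(* Tidiness bounds every exponent [d i], so all [d i - e] are nonnegative and the range condition in
   [A_poly] drops no term. *)
have d_range i : ((e <= d i) && (d i <= dm))%R.
  rewrite leNgt [(d i <= dm)%R]leNgt -negb_or orbC; apply/negP => /tau0 E.
  have : i \in tau d (d i) by rewrite inE.
  by rewrite E inE.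
pose dl i := `|d i - e|%N.
have dE i : d i = ((dl i)%:Z + e)%R.
  by have /andP[ei _] := d_range i; rewrite /dl; lia.
have dl_lt i : i != k0 -> (dl i < dl k0)%N.
  move=> ik; have : d i != dm.
    apply: contraNneq ik => di; have : i \in tau d dm by rewrite inE di.
    by rewrite tauE inE.
  by have /andP[ei id] := d_range i; rewrite /dl dk0; lia.
have [sW [sW_good sW_lin sW_rel]] := solved_relator R dE dl_lt m1.
set p := (\sum_(i < r) _)%R in sW_lin.
have [lam [pE lam_size lam_gt0]] : exists lam : seq R,
    [/\ p = (\prod_(z <- lam) ('X - z%:P))%R,
      (size lam).+1 = (dl k0).+1 & forall z, z \in lam -> (0 < z)%R].
  have psize : size (p - 'X^(dl k0))%R <= dl k0.
    rewrite /p (bigD1 k0) //= m1 scale1r addrAC subrr add0r.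
    apply: leq_trans (size_sum _ _ _) _; apply/bigmax_leqP => i ik.
    by rewrite (leq_trans (size_scale_leq _ _)) // size_polyXn dl_lt.
  have pXn : p = ('X^(dl k0) + (p - 'X^(dl k0)))%R by rewrite addrC subrK.
  have sp : size p = (dl k0).+1.
    by rewrite pXn size_polyDl size_polyXn.
  rewrite -sp; apply: real_rooted_split.
    by rewrite monicE pXn lead_coefDl ?lead_coefXn ?size_polyXn.
  move=> z; rewrite (_ : map_poly _ p = map_poly intr (A_poly m d)); first exact: A_roots.
  rewrite /A_poly -/e /p !rmorph_sum /= [RHS]big_mkcond; apply: eq_bigr => i _.
  have /andP[-> _] := d_range i.
  by rewrite !map_polyZ /= !map_polyXn rmorph_int.
move/eq_add_S: lam_size => lam_size; rewrite {}pE -lam_size in sW_lin sW_good sW_rel.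
case: G_pres => f [f_surj f_ker]; have fM : {morph f : u v / (u * v)%g} by exact: gmulfM.
pose x := f gen_x; pose t := f gen_t; pose K := size lam.
have fw : f w = 1%g by apply/f_ker => A [_]; apply.
have sWE : (x ^ (t ^+ K) = word_val (fun i => x ^ (t ^+ i)) sW)%g.
  apply/sW_rel; apply: etrans fw; rewrite wE /word_of (morph_prod fM); apply: eq_bigr => i _.
  by rewrite (morph_conj fM) !(morph_expgz fM).
pose good n (k : G -> utri R n.+1) := [/\ {morph k : u v / (u * v)%g},
    utri_mx (k x) ord0 ord0 = 1%R, utri_mx (k t) ord0 ord0 = 2%:R%R
    & forall i, (i < K)%N -> k (x ^ (t ^+ i))%g = gen_utri lam n i].
have rep n : exists k, @good n k.
  have [xn [tn [x00 t00 xE xW]]] := representation n lam_gt0 sW_good sW_lin.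
  pose h (u : F2) := word_val (fun c : bool => if c then tn else xn) (free_word u).
  have hM : {morph h : u v / (u * v)%g} by exact: free_word_valM.
  have hx : h gen_x = xn by rewrite /h /= word_val_cons word_val_nil mulg1.
  have ht : h gen_t = tn by rewrite /h /= word_val_cons word_val_nil mulg1.
  have [|k kM kf] := presentation_factor fM hM f_surj f_ker.
    move=> _ ->; rewrite wE /word_of (morph_prod hM).
    under eq_bigr do rewrite (morph_conj hM) !(morph_expgz hM) hx ht.
    (* The relator holds for the matrices because its solved form is the last property given by
       [representation]. *)
    by apply/sW_rel; rewrite xW; apply: eq_word_val => l /(allP sW_good)/xE->.
  exists k; rewrite /good !kf hx ht; split=> // i iK.
  rewrite -xE // (morph_conj kM) kf hx; congr (_ ^ _)%g.
  elim: i {iK} => [|i IHi]; first by rewrite !expg0 (morph_one kM).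
  by rewrite !expgS kM IHi kf ht.
have [k kP] : exists k : forall n, G -> utri R n.+1, forall n, good n (k n).
  by exists (fun n => projT1 (cid (rep n))) => n; exact: projT2.
apply: (@residually_bi_orderable G (fun n => utri R n.+1) k).
- by move=> n; have [] := kP n.
- by move=> n; exact: utri_bi_orderable.
move=> g k1; have [u fu] := f_surj g.
have [a [b [s [s_good sR gE]]]] := ascending_form sW_good sWE (free_word u).
have {}gE : g = (t ^+ a * word_val (fun i => x ^ (t ^+ i)) s * t ^- b)%g.
  rewrite -fu (free_morph_word_val u fM) -gE; apply: eq_word_val => l _.
  by case: l => [[]].
have kX n i : k n (t ^+ i)%g = (k n t ^+ i)%g.
  have [kM _ _ _] := kP n; elim: i => [|i IHi]; first by rewrite !expg0 (morph_one kM).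
  by rewrite !expgS kM IHi.
have kE n : k n g = (k n t ^+ a * word_val (k n \o (fun i => x ^ (t ^+ i))) s * (k n t) ^- b)%g.
  have [kM _ _ _] := kP n.
  by rewrite gE !kM (morph_inv kM) !kX (morph_word_val _ _ kM).
(* Matrices of size 1 suffice: the corner entry of the image of [g] is [2 ^ a / 2 ^ b], and it
   equals 1. *)
have ab : a = b.
  have [kM k00 t00 _] := kP 0%N.
  have := congr1 (fun M : utri R 1 => utri_mx M ord0 ord0) (kE 0%N).
  rewrite k1 !utri_diagM utri_diagV !utri_diagX t00 utri_diag_word_val => [|i]; last first.
    by rewrite /= (morph_conj kM) utri_diagJ.
  rewrite mulr1 mxE eqxx => /esym/divr1_eq/eqP.
  rewrite -!natrX eqr_nat eqn_exp2l // => /eqP; exact.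
(* With [a = b] the image of the middle word is conjugate to that of [g], hence trivial for every
   [n], and freeness applies. *)
have s0 : s = [::].
  apply: (gen_utri_free (lam := lam)) => // n; have [kM _ _ kg] := kP n.
  rewrite -(eq_word_val (g := k n \o (fun i => x ^ (t ^+ i))%g)); last first.
    by move=> l /(allP s_good) /kg.
  apply: (@mulgI _ (k n t ^+ a)%g); apply: (@mulIg _ (k n t ^- a)%g).
  by have := kE n; rewrite k1 -ab => <-; rewrite mulg1 mulgV.
by rewrite gE s0 word_val_nil mulg1 ab mulgV.
Qed.
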